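(* Let $(A,\circ)$ be a commutative associative algebra over $\mathbf{k}$, let $(A_h,\circ_h)$ be an associative deformation of $(A,\circ)$, and let $(A,\{,\},\circ)$ be the corresponding quasiclassical limit (a Poisson algebra). Let $r=\sum_i a_i\otimes b_i\in A\otimes A$ be a solution of the associative Yang-Baxter equation (AYBE) in $(A,\circ)$ such that $r+\sigma(r)$ is $(A,\circ)$-invariant. Let $\hat r$ denote the image of $r$ under the linear embedding of $A\otimes A$ into $A_h\hat\otimes A_h$. Suppose that $\hat r$ is a solution of the AYBE in $(A_h,\circ_h)$ and that $\hat r+\sigma_{\mathbf K}(\hat r)$ is $(A_h,\circ_h)$-invariant. Then $r$ is a solution of the Poisson Yang-Baxter equation (PYBE) in $(A,\{,\},\circ)$ and $r+\sigma(r)$ is $(A,\{,\},\circ)$-invariant.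
   Context: Throughout, $\mathbf{k}$ is a field of characteristic $0$ and $\mathbf{K}=\mathbf{k}[[h]]$. For a vector space $V$, $V_h=V[[h]]$ is the corresponding topologically free $\mathbf K$-module with the $h$-adic topology; $\hat\otimes$ is the $h$-adically completed tensor product over $\mathbf K$, so $V_h\hat\otimes W_h\cong (V\otimes W)[[h]]$. A topologically free associative algebra is $(A_h,\circ_h)$ with $A_h=A[[h]]$ and $\circ_h$ a $\mathbf K$-bilinear associative product. It is an associative deformation of an associative algebra $(A,\circ)$ if $x\circ_h y\equiv x\circ y \pmod h$ for $x,y\in A$. If $(A,\circ)$ is commutative, the quasiclassical limit (QCL) of the deformation is $(A,\{,\},\circ)$ with $\{x,y\}\in A$, $\{x,y\}\equiv \frac{x\circ_h y-y\circ_h x}{h}\pmod h$; it is known to be a Poisson algebra. AYBE: for an associative algebra $(A,\circ)$ and $r=\sum_i a_i\otimes b_i\in A\otimes A$, $r$ is a solution of the AYBE if $\mathbf A(r):=r_{12}\circ r_{13}+r_{13}\circ r_{23}-r_{23}\circ r_{12}=0$, where $r_{12}\circ r_{13}=\sum_{i,j}a_i\circ a_j\otimes b_i\otimes b_j$, $r_{13}\circ r_{23}=\sum_{i,j}a_i\otimes a_j\otimes b_i\circ b_j$, $r_{23}\circ r_{12}=\sum_{i,j}a_j\otimes a_i\circ b_j\otimes b_i$. The AYBE in $(A_h,\circ_h)$ for an element of $A_h\hat\otimes A_h$ is defined by the same formulas with $\hat\otimes$ and $\circ_h$. $\sigma(x\otimes y)=y\otimes x$ on $A\otimes A$, and $\sigma_{\mathbf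 K}$ is its $\mathbf K$-linear extension to $A_h\hat\otimes A_h$. With $L_\circ(x)y=x\circ y$, $R_\circ(x)y=y\circ x$, an element $\beta$ is $(A,\circ)$-invariant if $(\mathrm{id}\otimes L_\circ(x)-R_\circ(x)\otimes\mathrm{id})\beta=0$ for all $x\in A$ (similarly for $(A_h,\circ_h)$ with $\hat\otimes$ and $x\in A_h$). For a Lie algebra $(A,\{,\})$, $\beta$ is $(A,\{,\})$-invariant if $(\mathrm{ad}(x)\otimes\mathrm{id}+\mathrm{id}\otimes\mathrm{ad}(x))\beta=0$ for all $x\in A$, where $\mathrm{ad}(x)y=\{x,y\}$. For a Poisson algebra, $\beta$ is $(A,\{,\},\circ)$-invariant if it is both $(A,\{,\})$- and $(A,\circ)$-invariant. CYBE: $\mathbf C(r):=[r_{12},r_{13}]+[r_{12},r_{23}]+[r_{13},r_{23}]=0$, where $[r_{12},r_{13}]=\sum_{i,j}\{a_i,a_j\}\otimes b_i\otimes b_j$, $[r_{12},r_{23}]=\sum_{i,j}a_i\otimes\{b_i,a_j\}\otimes b_j$, $[r_{13},r_{23}]=\sum_{i,j}a_i\otimes a_j\otimes\{b_i,b_j\}$. The PYBE in a Poisson algebra $(A,\{,\},\circ)$ is $\mathbf A(r)=\mathbf C(r)=0$. *)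

(* Defs.v *)
From HB Require Import structures.
From mathcomp Require Import all_boot all_order all_algebra.
From mathcomp Require Import boolp.

Set Implicit Arguments.
Unset Strict Implicit.
Unset Printing Implicit Defensive.

Import GRing.Theory.
Local Open Scope ring_scope.
Local Open Scope quotient_scope.

Section Tensor.
Variables (R : comNzRingType) (V W : lmodType R).

(* The sequence (x_1, y_1), ..., (x_n, y_n) stands for the sum of the         *)
(* x_i (x) y_i; no coefficients are needed since they are absorbed in x_i.    *)
Inductive tens_rel : seq (V * W) -> seq (V * W) -> Prop :=
| tens_refl s : tens_rel s s
| tens_sym s t : tens_rel s t -> tens_rel t s
| tens_trans t s u : tens_rel s t -> tens_rel t u -> tens_rel s u
| tens_cat s s' t t' :
    tens_rel s s' -> tens_rel t t' -> tens_rel (s ++ t) (s' ++ t')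
| tens_catC s t : tens_rel (s ++ t) (t ++ s)
| tens_0 y : tens_rel [:: (0, y)] [::]
| tens_Dl x x' y : tens_rel [:: (x + x', y)] [:: (x, y); (x', y)]
| tens_Dr x y y' : tens_rel [:: (x, y + y')] [:: (x, y); (x, y')]
| tens_Z a x y : tens_rel [:: (a *: x, y)] [:: (x, a *: y)].

Definition tens_equiv (s t : seq (V * W)) : bool := `[< tens_rel s t >].

Lemma tens_equiv_refl : reflexive tens_equiv.
Proof. by move=> s; apply/asboolP/tens_refl. Qed.

Lemma tens_equiv_sym : symmetric tens_equiv.
Proof. by move=> s t; apply/asboolP/asboolP; apply: tens_sym. Qed.

Lemma tens_equiv_trans : transitive tens_equiv.
Proof.
by move=> t s u /asboolP st /asboolP tu; apply/asboolP/(tens_trans st tu).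
Qed.

Canonical tens_equiv_equiv :=
  EquivRel tens_equiv tens_equiv_refl tens_equiv_sym tens_equiv_trans.

Definition tensor : Type := {eq_quot tens_equiv}.
HB.instance Definition _ : EqQuotient _ tens_equiv tensor :=
  EqQuotient.on tensor.
HB.instance Definition _ := Choice.on tensor.

Definition tens (x : V) (y : W) : tensor := \pi_tensor [:: (x, y)].

Definition tens_add (s t : tensor) : tensor := \pi_tensor (repr s ++ repr t).
Definition tens_opp (s : tensor) : tensor :=
  \pi_tensor [seq (- p.1, p.2) | p <- repr s].
Definition tens_scale (a : R) (s : tensor) : tensor :=
  \pi_tensor [seq (a *: p.1, p.2) | p <- repr s].

Lemma tens_quotW (P : tensor -> Prop) :
  (forall s, P (\pi_tensor s)) -> forall t, P t.
Proof. by move=> Ppi t; rewrite -[t]reprK; apply: Ppi. Qed.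

Lemma tens_relP s t : \pi_tensor s = \pi_tensor t <-> tens_rel s t.
Proof.
by split=> [/eqmodP/asboolP //|st]; apply/eqmodP/asboolP.
Qed.

Lemma repr_rel s : tens_rel (repr (\pi_tensor s)) s.
Proof. by apply/tens_relP; rewrite reprK. Qed.

Lemma tens_rel_map (f : V -> V) : {morph f : x y / x + y} -> f 0 = 0 ->
    (forall a, {morph f : x / a *: x}) ->
  forall s t, tens_rel s t ->
  tens_rel [seq (f p.1, p.2) | p <- s] [seq (f p.1, p.2) | p <- t].
Proof.
move=> fD f0 fZ s t; elim=> {s t} /= [s|s t _|t s u _ + _|s s' t t' _ + _|s t|y|x x' y|x y y'|a x y].
- exact: tens_refl.
- exact: tens_sym.
- exact: tens_trans.
- by rewrite !map_cat; apply: tens_cat.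
- by rewrite !map_cat; apply: tens_catC.
- by rewrite f0; apply: tens_0.
- by rewrite fD; apply: tens_Dl.
- exact: tens_Dr.
- by rewrite fZ; apply: tens_Z.
Qed.

Lemma tens_rel_opp s t : tens_rel s t ->
  tens_rel [seq (- p.1, p.2) | p <- s] [seq (- p.1, p.2) | p <- t].
Proof.
apply: (tens_rel_map (f := -%R)) => [x y||a x].
- by rewrite opprD.
- by rewrite oppr0.
- by rewrite scalerN.
Qed.

Lemma tens_rel_scale a s t : tens_rel s t ->
  tens_rel [seq (a *: p.1, p.2) | p <- s] [seq (a *: p.1, p.2) | p <- t].
Proof.
move=> st; apply: tens_rel_map st => [x y||b x].
- by rewrite scalerDr.
- by rewrite scaler0.
- by rewrite !scalerA mulrC.
Qed.

Lemma pi_cat s t :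
  \pi_tensor (s ++ t) = tens_add (\pi_tensor s) (\pi_tensor t).
Proof.
by apply/tens_relP/tens_sym/tens_cat; apply: repr_rel.
Qed.

Lemma pi_opp s :
  \pi_tensor [seq (- p.1, p.2) | p <- s] = tens_opp (\pi_tensor s).
Proof. by apply/tens_relP/tens_sym/tens_rel_opp/repr_rel. Qed.

Lemma pi_scale a s :
  \pi_tensor [seq (a *: p.1, p.2) | p <- s] = tens_scale a (\pi_tensor s).
Proof. by apply/tens_relP/tens_sym/tens_rel_scale/repr_rel. Qed.

Lemma tens_addA : associative tens_add.
Proof.
by move=> s t u; elim/tens_quotW: s => s; elim/tens_quotW: t => t; elim/tens_quotW: u => u; rewrite -!pi_cat catA.
Qed.

Lemma tens_addC : commutative tens_add.
Proof.
by move=> s t; elim/tens_quotW: s => s; elim/tens_quotW: t => t; rewrite -!pi_cat; apply/tens_relP/tens_catC.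
Qed.

Lemma tens_add0 : left_id (\pi_tensor [::]) tens_add.
Proof. by move=> s; elim/tens_quotW: s => s; rewrite -pi_cat. Qed.

Lemma tens_addN : left_inverse (\pi_tensor [::]) tens_opp tens_add.
Proof.
move=> s; elim/tens_quotW: s => s; rewrite -pi_opp -pi_cat; apply/tens_relP.
elim: s => [|[x y] s IHs] /=; first exact: tens_refl.
set t := map _ _ in IHs *.
have swap : tens_rel (t ++ [:: (x, y)] ++ s) ([:: (x, y)] ++ t ++ s).
  by rewrite !catA; apply: tens_cat; [apply: tens_catC|apply: tens_refl].
have xN : tens_rel ([:: (- x, y)] ++ [:: (x, y)]) [::].
  apply: tens_trans (tens_0 y); apply: tens_sym.
  by rewrite -(addNr x); apply: tens_Dl.
apply: (tens_trans (tens_cat (tens_refl [:: (- x, y)]) swap)).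
by rewrite catA; apply: tens_cat xN IHs.
Qed.

HB.instance Definition _ := GRing.isZmodule.Build tensor
  tens_addA tens_addC tens_add0 tens_addN.

Lemma piD s t : \pi_tensor (s ++ t) = \pi_tensor s + \pi_tensor t.
Proof. exact: pi_cat. Qed.

Lemma tensDl x x' y : tens (x + x') y = tens x y + tens x' y.
Proof. by rewrite /tens -piD; apply/tens_relP/tens_Dl. Qed.

Lemma tensDr x y y' : tens x (y + y') = tens x y + tens x y'.
Proof. by rewrite /tens -piD; apply/tens_relP/tens_Dr. Qed.

Lemma tens_pi s : \pi_tensor s = \sum_(p <- s) tens p.1 p.2.
Proof.
elim: s => [|[x y] s IHs]; first by rewrite big_nil.
by rewrite big_cons -IHs -cat1s piD.
Qed.

Lemma tens_decomp t : t = \sum_(p <- repr t) tens p.1 p.2.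
Proof. by rewrite -tens_pi reprK. Qed.

Lemma tens_scaleA a b s : tens_scale a (tens_scale b s) = tens_scale (a * b) s.
Proof.
elim/tens_quotW: s => s; rewrite -!pi_scale -map_comp.
by congr (\pi_tensor _); apply: eq_map => p /=; rewrite scalerA.
Qed.

Lemma tens_scale1 : left_id 1 tens_scale.
Proof.
move=> s; elim/tens_quotW: s => s; rewrite -!pi_scale; congr (\pi_tensor _).
by rewrite -[RHS]map_id; apply: eq_map => -[x y] /=; rewrite scale1r.
Qed.

Lemma tens_scaleDr : right_distributive tens_scale +%R.
Proof.
move=> a s t; elim/tens_quotW: s => s; elim/tens_quotW: t => t.
by rewrite -piD -!pi_scale map_cat piD.
Qed.

Lemma tens_scaleDl s : {morph tens_scale^~ s : a b / a + b}.
Proof.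
move=> a b; elim/tens_quotW: s => s /=; rewrite -!pi_scale !tens_pi !big_map.
rewrite -big_split; apply: eq_bigr => p _ /=.
by rewrite scalerDl tensDl.
Qed.

HB.instance Definition _ := GRing.Zmodule_isLmodule.Build R tensor
  tens_scaleA tens_scale1 tens_scaleDr tens_scaleDl.

Lemma piZ a s :
  \pi_tensor [seq (a *: p.1, p.2) | p <- s] = a *: \pi_tensor s.
Proof. exact: pi_scale. Qed.

Lemma tensZl a x y : tens (a *: x) y = a *: tens x y.
Proof. by rewrite -piZ. Qed.

Lemma tensZr a x y : tens x (a *: y) = a *: tens x y.
Proof. by rewrite -tensZl; apply/tens_relP/tens_sym/tens_Z. Qed.

(* For t = \sum_i x_i (x) y_i and f bilinear this is \sum_i f x_i y_i,        *)
(* whatever the decomposition of t: see tsum_pi and tsum_tens.                *)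
Definition tsum (U : zmodType) (f : V -> W -> U) (t : tensor) : U :=
  \sum_(p <- repr t) f p.1 p.2.

Section Universal.
Variables (U : lmodType R) (f : {bilinear V -> W -> U}).

Lemma tsum_pi s : tsum f (\pi_tensor s) = \sum_(p <- s) f p.1 p.2.
Proof.
rewrite /tsum; move: (repr _) (repr_rel s) => t; elim=> {s t} /=
  [//|s t _ -> //|t s u _ -> _ -> //|s s' t t' _ + _|s t|y|x x' y|x y y'|a x y].
- by rewrite !big_cat /= => -> ->.
- by rewrite !big_cat /= addrC.
- by rewrite !big_cons !big_nil /= linear0l addr0.
- by rewrite !big_cons !big_nil /= linearDl !addr0.
- by rewrite !big_cons !big_nil /= linearDr !addr0.
- by rewrite !big_cons !big_nil /= linearZl linearZr.
Qed.

Lemma tsum_tens x y : tsum f (tens x y) = f x y.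
Proof. by rewrite tsum_pi big_seq1. Qed.

Lemma tsum_is_linear : linear (tsum f).
Proof.
move=> a s t; elim/tens_quotW: s => s; elim/tens_quotW: t => t.
rewrite -piZ -piD !tsum_pi.
rewrite big_cat big_map scaler_sumr; congr (_ + _).
by apply: eq_bigr => p _; rewrite linearZl.
Qed.

HB.instance Definition _ :=
  GRing.isLinear.Build R tensor U *:%R (tsum f) tsum_is_linear.

Lemma tsum_uniq (g : {linear tensor -> U}) :
  (forall x y, g (tens x y) = f x y) -> g =1 tsum f.
Proof.
move=> gE t; rewrite {1}[t]tens_decomp linear_sum.
by apply: eq_bigr => p _.
Qed.

End Universal.
End Tensor.

Arguments tens {R V W}.

Definition tmap (R : comNzRingType) (V W V' W' : lmodType R)
    (f : V -> V') (g : W -> W') : tensor V W -> tensor V' W' :=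
  tsum (fun x y => tens (f x) (g y)).

Record fps (V : Type) := Fps { fps_coef :> nat -> V }.

Lemma fpsP V (u v : fps V) : u =1 v <-> u = v.
Proof. by case: u v => u [v]; split=> [/funext /= -> | ->]. Qed.

HB.instance Definition _ (V : Type) := gen_eqMixin (fps V).
HB.instance Definition _ (V : Type) := gen_choiceMixin (fps V).

Definition fps_map (V W : Type) (f : V -> W) (u : fps V) : fps W :=
  Fps (fun n => f (u n)).

Section FpsZmodule.
Variable V : zmodType.

Definition fpsC (x : V) : fps V := Fps (fun n => if n is 0%N then x else 0).

Definition fps_add (u v : fps V) : fps V := Fps (fun n => u n + v n).
Definition fps_opp (u : fps V) : fps V := Fps (fun n => - u n).

Lemma fps_addA : associative fps_add.
Proof. by move=> u v w; apply/fpsP => n /=; rewrite addrA. Qed.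

Lemma fps_addC : commutative fps_add.
Proof. by move=> u v; apply/fpsP => n /=; rewrite addrC. Qed.

Lemma fps_add0 : left_id (fpsC 0) fps_add.
Proof. by move=> u; apply/fpsP => -[|n] /=; rewrite add0r. Qed.

Lemma fps_addN : left_inverse (fpsC 0) fps_opp fps_add.
Proof. by move=> u; apply/fpsP => -[|n] /=; rewrite addNr. Qed.

HB.instance Definition _ := GRing.isZmodule.Build (fps V)
  fps_addA fps_addC fps_add0 fps_addN.

Lemma fpsD (u v : fps V) n : (u + v) n = u n + v n. Proof. by []. Qed.
Lemma fpsN (u : fps V) n : (- u) n = - u n. Proof. by []. Qed.
Lemma fps0 n : (0 : fps V) n = 0. Proof. by case: n. Qed.

End FpsZmodule.

(* The product of series induced by a biadditive map op. *)
Definition cauchy (U V : Type) (W : zmodType) (op : U -> V -> W)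
    (u : fps U) (v : fps V) : fps W :=
  Fps (fun n => \sum_(i < n.+1) op (u i) (v (n - i)%N)).

Lemma cauchyS (U V : Type) (W : zmodType) (op : U -> V -> W) u v n :
  cauchy op u v n.+1 =
    op (u 0%N) (v n.+1) + cauchy op (Fps (fun i => u i.+1)) v n.
Proof. by rewrite /= big_ord_recl subn0. Qed.

Lemma morph0 (U V : zmodType) (f : U -> V) :
  {morph f : x y / x + y} -> f 0 = 0.
Proof. by move=> fD; apply: (addrI (f 0)); rewrite -fD !addr0. Qed.

Lemma cauchyDl (U : zmodType) (V : Type) (W : zmodType) (op : U -> V -> W) :
  (forall y, {morph op^~ y : x x' / x + x'}) ->
  forall v, {morph cauchy op^~ v : u u' / u + u'}.
Proof.
move=> opD v u u'; apply/fpsP => n /=; rewrite -big_split.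
by apply: eq_bigr => i _; apply: opD.
Qed.

Lemma cauchyDr (U : Type) (V W : zmodType) (op : U -> V -> W) :
  (forall x, {morph op x : y y' / y + y'}) ->
  forall u, {morph cauchy op u : v v' / v + v'}.
Proof.
move=> opD u v v'; apply/fpsP => n /=; rewrite -big_split.
by apply: eq_bigr => i _; apply: opD.
Qed.

Lemma cauchyCl (U : zmodType) (V : Type) (W : zmodType) (op : U -> V -> W) :
  (forall y, op 0 y = 0) ->
  forall x v, cauchy op (fpsC x) v = fps_map (op x) v.
Proof.
move=> op0 x v; apply/fpsP => n /=.
by rewrite big_ord_recl subn0 big1 ?addr0 // => i _; rewrite op0.
Qed.

Lemma cauchyA (A B C : Type) (AB BC D : zmodType)
    (ab : A -> B -> AB) (ab_c : AB -> C -> D)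
    (bc : B -> C -> BC) (a_bc : A -> BC -> D) :
  (forall z, {morph ab_c^~ z : x y / x + y}) ->
  (forall x, {morph a_bc x : y z / y + z}) ->
  (forall x y z, a_bc x (bc y z) = ab_c (ab x y) z) ->
  forall u v w,
  cauchy a_bc u (cauchy bc v w) = cauchy ab_c (cauchy ab u v) w.
Proof.
move=> ab_cD a_bcD opA u v w; apply/fpsP => n; elim: n u v => [|n IHn] u v.
  by rewrite /= !big_ord1.
rewrite !cauchyS a_bcD IHn -addrA.
have -> : cauchy ab u v 0%N = ab (u 0%N) (v 0%N) by rewrite /= big_ord1.
rewrite -opA.
congr (_ + _); set u' : fps A := Fps (fun i => u i.+1).
have -> : Fps (fun i => cauchy ab u v i.+1) =
    fps_map (ab (u 0%N)) (Fps (fun i => v i.+1)) + cauchy ab u' v.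
  by apply/fpsP => i; rewrite [LHS]cauchyS.
rewrite (cauchyDl ab_cD) fpsD; congr (_ + _) => /=.
rewrite [LHS](big_morph _ (a_bcD _) (morph0 (a_bcD _))).
by apply: eq_bigr => i _; rewrite opA.
Qed.

Section FpsRing.
Variable R : comNzRingType.

Definition fpsX : fps R := Fps (fun n => (n == 1%N)%:R).
Definition fps_mul : fps R -> fps R -> fps R := cauchy *%R.

Lemma fps_mulA : associative fps_mul.
Proof.
by apply: cauchyA => [z x y|x y z|x y z]; rewrite ?mulrDl ?mulrDr ?mulrA.
Qed.

Lemma fps_mulC : commutative fps_mul.
Proof.
move=> u v; apply/fpsP => n /=; rewrite (reindex_inj rev_ord_inj).
apply: eq_bigr => i _ /=.
by rewrite subSS subKn -1?ltnS // mulrC.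
Qed.

Lemma fps_mul1 : left_id (fpsC 1) fps_mul.
Proof.
move=> u; rewrite [LHS]cauchyCl; last exact: mul0r.
by apply/fpsP => n /=; rewrite mul1r.
Qed.

Lemma fps_mulDl : left_distributive fps_mul +%R.
Proof. by move=> u v w; apply: cauchyDl => z x y; exact: mulrDl. Qed.

Lemma fps_1neq0 : fpsC (1 : R) != 0.
Proof.
by apply/eqP => /(congr1 (fun u : fps R => u 0%N))/eqP; rewrite oner_eq0.
Qed.

HB.instance Definition _ := GRing.Zmodule_isComNzRing.Build (fps R)
  fps_mulA fps_mulC fps_mul1 fps_mulDl fps_1neq0.

Variable V : lmodType R.

Definition fps_scale : fps R -> fps V -> fps V := cauchy *:%R.

Lemma fps_scaleA a b u : fps_scale a (fps_scale b u) = fps_scale (a * b) u.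
Proof.
by apply: cauchyA => [y c d|c x y|c d x]; rewrite ?scalerDl ?scalerDr ?scalerA.
Qed.

Lemma fps_scale1 : left_id 1 fps_scale.
Proof.
move=> u; rewrite [LHS]cauchyCl; last exact: scale0r.
by apply/fpsP => n /=; rewrite scale1r.
Qed.

Lemma fps_scaleDr : right_distributive fps_scale +%R.
Proof. by move=> a u v; apply: cauchyDr => x y z; exact: scalerDr. Qed.

Lemma fps_scaleDl u : {morph fps_scale^~ u : a b / a + b}.
Proof. by apply: cauchyDl => x b c; exact: scalerDl. Qed.

HB.instance Definition _ := GRing.Zmodule_isLmodule.Build (fps R) (fps V)
  fps_scaleA fps_scale1 fps_scaleDr fps_scaleDl.

Lemma fpsXZS (u : fps V) n : (fpsX *: u) n.+1 = u n.
Proof.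
rewrite [LHS]cauchyS scale0r add0r /= big_ord_recl scale1r subn0.
by rewrite big1 ?addr0 // => i _; rewrite scale0r.
Qed.

Lemma fpsCZ a (u : fps V) n : (fpsC a *: u) n = a *: u n.
Proof. by rewrite [_ *: u]cauchyCl //; exact: scale0r. Qed.

Lemma fpsCM a (x : V) : fpsC (a *: x) = fpsC a *: fpsC x.
Proof. by apply/fpsP => -[|n]; rewrite fpsCZ /= ?scaler0. Qed.

Lemma fpsCD (x y : V) : fpsC (x + y) = fpsC x + fpsC y.
Proof. by apply/fpsP => -[|n] //=; rewrite addr0. Qed.

Lemma fps_split (u : fps V) :
  u = fpsC (u 0%N) + fpsX *: Fps (fun n => u n.+1).
Proof.
by apply/fpsP => -[|n]; rewrite fpsD ?fpsXZS /= ?big_ord1 ?scale0r ?addr0 ?add0r.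
Qed.

Lemma fpsXZ0 (u : fps V) : (fpsX *: u) 0%N = 0.
Proof. by rewrite /= big_ord1 scale0r. Qed.

End FpsRing.

Arguments fpsX {R}.

Lemma linear_fps_eq (R : comNzRingType) (V W : lmodType R)
    (f g : fps V -> fps W) :
  linear f -> linear g ->
  (forall x, f (fpsC x) = g (fpsC x)) -> f =1 g.
Proof.
move=> fZD gZD fg u; apply/fpsP => n; elim: n u => [|n IHn] u.
  by rewrite (fps_split u) addrC fZD gZD fg !fpsD !fpsXZ0.
by rewrite (fps_split u) addrC fZD gZD fg !fpsD !fpsXZS IHn.
Qed.

(* The h-adically completed tensor product of V[[h]] and W[[h]] over R[[h]]   *)
(* is taken to be (tensor V W)[[h]]. Its pure tensors are the ctens u v, and  *)
(* csum_ctens and csum_uniq give the universal property: each R[[h]]-bilinear *)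
(* map f to some U[[h]] factors uniquely through ctens, by csum f.            *)
Section CompletedTensor.
Variables (R : comNzRingType) (V W : lmodType R).

Definition ctens : fps V -> fps W -> fps (tensor V W) := cauchy tens.

(* For t = \sum_n h^n t_n with t_n in tensor V W, this is                     *)
(* \sum_n h^n (tsum f t_n), f being restricted to constant series.            *)
Definition csum (U : zmodType) (f : fps V -> fps W -> fps U)
    (t : fps (tensor V W)) : fps U :=
  Fps (fun n => \sum_(i < n.+1)
    tsum (fun x y => f (fpsC x) (fpsC y)) (t i) (n - i)%N).

Lemma ctensDl v : {morph ctens^~ v : u u' / u + u'}.
Proof. by apply: cauchyDl => y x x'; exact: tensDl. Qed.

Lemma ctensDr u : {morph ctens u : v v' / v + v'}.
Proof. by apply: cauchyDr => x y y'; exact: tensDr. Qed.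

Lemma ctensZl a u v : ctens (a *: u) v = a *: ctens u v.
Proof.
symmetry; apply: cauchyA => [y x x'|b x y|b x y].
- exact: tensDl.
- exact: scalerDr.
- by rewrite tensZl.
Qed.

Lemma ctensZr a u v : ctens u (a *: v) = a *: ctens u v.
Proof.
rewrite -ctensZl; have -> : a *: u = cauchy (fun x b => b *: x) u a.
  apply/fpsP => n /=; rewrite (reindex_inj rev_ord_inj).
  by apply: eq_bigr => i _ /=; rewrite subSS subKn -1?ltnS.
apply: cauchyA => [y x x'|x y y'|x b y].
- exact: tensDl.
- exact: tensDr.
- by rewrite tensZl tensZr.
Qed.

Lemma ctens_is_bilinear : bilinear_for *:%R *:%R ctens.
Proof.
split=> [v a u u'|u a v v'] /=.
- by rewrite ctensDl ctensZl.
- by rewrite ctensDr ctensZr.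
Qed.

HB.instance Definition _ := bilinear_isBilinear.Build (fps R) (fps V) (fps W)
  (fps (tensor V W)) *:%R *:%R ctens ctens_is_bilinear.

Lemma ctensC x y : ctens (fpsC x) (fpsC y) = fpsC (tens x y).
Proof.
rewrite /ctens cauchyCl; last first.
  by move=> z; rewrite -[0](scale0r 0) tensZl scale0r.
apply/fpsP => -[|n] //=.
by rewrite -[0](scale0r 0) tensZr scale0r.
Qed.

Section Universal.
Variables (U : lmodType R) (f : {bilinear fps V -> fps W -> fps U}).

Definition csum_coef n (x : V) (y : W) : U := f (fpsC x) (fpsC y) n.

Lemma csum_coef_bilinear n : bilinear_for *:%R *:%R (csum_coef n).
Proof.
by split=> [y a x x'|x a y y'] /=; rewrite /csum_coef fpsCD fpsCM
  ?linearDl ?linearDr ?linearZl ?linearZr fpsD fpsCZ.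
Qed.

HB.instance Definition _ n := bilinear_isBilinear.Build R V W U *:%R *:%R
  (csum_coef n) (csum_coef_bilinear n).

Definition csum_lin n : {linear tensor V W -> U} :=
  tsum (csum_coef n).

Lemma csumE t : csum f t =
  cauchy (fun s (g : {linear tensor V W -> U}) => g s) t (Fps csum_lin).
Proof.
apply/fpsP => n /=; apply: eq_bigr => i _; rewrite /tsum.
by rewrite (big_morph (fun u : fps U => u (n - i)%N) (fun u v => fpsD u v _) (fps0 _ _)).
Qed.

Lemma csum_is_linear : linear (csum f).
Proof.
move=> a s t; rewrite !csumE cauchyDl; last by move=> g x y; rewrite linearD.
congr (_ + _); symmetry; apply: cauchyA => [g x y|b x y|b x g].
- by rewrite linearD.
- exact: scalerDr.
- by rewrite linearZ.
Qed.

HB.instance Definition _ := GRing.isLinear.Build (fps R) (fps (tensor V W))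
  (fps U) *:%R (csum f) csum_is_linear.

Lemma csum_ctensC x y : csum f (ctens (fpsC x) (fpsC y)) = f (fpsC x) (fpsC y).
Proof.
rewrite csumE ctensC cauchyCl; last by move=> g; rewrite linear0.
by apply/fpsP => n /=; rewrite tsum_tens.
Qed.

Lemma csum_ctens u v : csum f (ctens u v) = f u v.
Proof.
apply: (linear_fps_eq (f := fun u => csum f (ctens u v)) (g := f^~ v)).
- by move=> a x y /=; rewrite ctensDl ctensZl linearP.
- by move=> a x y; rewrite linearPl.
move=> {u} x; apply: (linear_fps_eq (f := fun v => csum f (ctens (fpsC x) v))).
- by move=> a y z /=; rewrite ctensDr ctensZr linearP.
- by move=> a y z; rewrite linearP.
- exact: csum_ctensC.
Qed.

Lemma csum_uniq (g : {linear fps (tensor V W) -> fps U}) :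
  (forall u v, g (ctens u v) = f u v) -> g =1 csum f.
Proof.
move=> gE; apply: linear_fps_eq; [exact: linearP|exact: linearP|] => t.
rewrite [t]tens_decomp (big_morph _ (@fpsCD _ _) (erefl _)).
rewrite !linear_sum; apply: eq_bigr => p _.
have <- : ctens (fpsC p.1) (fpsC p.2) = fpsC (tens p.1 p.2).
  exact: ctensC.
by rewrite gE; apply/esym/csum_ctens.
Qed.

End Universal.
End CompletedTensor.

Definition cmap (R : comNzRingType) (V W V' W' : lmodType R)
    (f : fps V -> fps V') (g : fps W -> fps W') :
    fps (tensor V W) -> fps (tensor V' W') :=
  csum (fun u v => ctens (f u) (g v)).

(* The Yang-Baxter expressions, for M the algebra, T2 and T3 its tensor       *)
(* square and cube, t3 the pure tensors of T3, and sum f r = \sum_i f a_i b_i *)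
(* for r = \sum_i a_i (x) b_i.                                                *)
Section YangBaxter.
Variables (M T2 : Type) (T3 : zmodType) (t3 : M -> M -> M -> T3).
Variables (sum : (M -> M -> T3) -> T2 -> T3) (m : M -> M -> M) (r : T2).

Let sum_ij (f : M -> M -> M -> M -> T3) : T3 :=
  sum (fun ai bi => sum (fun aj bj => f ai bi aj bj) r) r.

Definition aybe_expr : T3 :=
  sum_ij (fun ai bi aj bj => t3 (m ai aj) bi bj)
  + sum_ij (fun ai bi aj bj => t3 ai aj (m bi bj))
  - sum_ij (fun ai bi aj bj => t3 aj (m ai bj) bi).

Definition cybe_expr : T3 :=
  sum_ij (fun ai bi aj bj => t3 (m ai aj) bi bj)
  + sum_ij (fun ai bi aj bj => t3 ai (m bi aj) bj)
  + sum_ij (fun ai bi aj bj => t3 ai aj (m bi bj)).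

End YangBaxter.

Section Classical.
Variables (R : comNzRingType) (A : lmodType R).
Implicit Types (m br : A -> A -> A) (r b : tensor A A).

Definition tens3 (x y z : A) : tensor (tensor A A) A := tens (tens x y) z.

Definition flip : tensor A A -> tensor A A := tsum (fun x y => tens y x).

Definition aybe m r : Prop := aybe_expr tens3 (@tsum R A A _) m r = 0.
Definition cybe br r : Prop := cybe_expr tens3 (@tsum R A A _) br r = 0.
Definition pybe m br r : Prop := aybe m r /\ cybe br r.

Definition assoc_invariant m b : Prop :=
  forall x, tmap id (m x) b - tmap (m^~ x) id b = 0.
Definition lie_invariant br b : Prop :=
  forall x, tmap (br x) id b + tmap id (br x) b = 0.
Definition poisson_invariant m br b : Prop :=
  lie_invariant br b /\ assoc_invariant m b.

Record is_poisson m br : Prop := IsPoisson {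
  poisson_bilinear : bilinear_for *:%R *:%R br;
  poisson_alt : forall x, br x x = 0;
  poisson_jacobi : forall x y z,
    br (br x y) z + br (br y z) x + br (br z x) y = 0;
  poisson_mulA : associative m;
  poisson_mulC : commutative m;
  poisson_leibniz : forall x y z, br x (m y z) = m (br x y) z + m y (br x z)
}.

End Classical.

Section Deformation.
Variables (R : comNzRingType) (A : lmodType R).
Implicit Types (mh : fps A -> fps A -> fps A) (r b : fps (tensor A A)).

Definition ctens3 (x y z : fps A) : fps (tensor (tensor A A) A) :=
  ctens (ctens x y) z.

(* The R[[h]]-linear extension of a linear map acts coefficient by coefficient. *)
Definition cflip : fps (tensor A A) -> fps (tensor A A) :=
  fps_map (@flip R A).

Definition caybe mh r : Prop := aybe_expr ctens3 (@csum R A A _) mh r = 0.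

Definition cassoc_invariant mh b : Prop :=
  forall x, cmap id (mh x) b - cmap (mh^~ x) id b = 0.

Definition eqmod_h (u v : fps A) : Prop := exists w, u - v = fpsX *: w.

Definition is_deformation (m : A -> A -> A) mh : Prop :=
  associative mh /\
  forall x y, eqmod_h (mh (fpsC x) (fpsC y)) (fpsC (m x y)).

(* (x o_h y - y o_h x) / h is the q such that h q = x o_h y - y o_h x; it is  *)
(* unique since multiplication by h is injective.                             *)
Definition is_qcl mh (br : A -> A -> A) : Prop :=
  forall x y, exists2 q,
    mh (fpsC x) (fpsC y) - mh (fpsC y) (fpsC x) = fpsX *: q &
    eqmod_h q (fpsC (br x y)).

End Deformation.

(* The quasiclassical limit is a Poisson algebra; in particular its bracket   *)
(* is bilinear, so that the expressions built from it by tsum make sense.     *)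
Section QclPoisson.
Variables (R : comNzRingType) (A : lmodType R) (m : {bilinear A -> A -> A}).
Variables (mh : {bilinear fps A -> fps A -> fps A}) (br : A -> A -> A).
Hypotheses (mC : commutative m) (def : is_deformation m mh).
Hypothesis qcl : is_qcl mh br.

Let c u v := mh u v - mh v u.

Lemma eqmod_h0 (u v : fps A) : eqmod_h u v -> u 0%N = v 0%N.
Proof.
by case=> w /(congr1 (fun t : fps A => t 0%N)) /eqP; rewrite fpsXZ0 subr_eq0 => /eqP.
Qed.

Lemma deform0 u v : mh u v 0%N = m (u 0%N) (v 0%N).
Proof.
rewrite {1}(fps_split u) {1}(fps_split v) !(linearDl, linearDr).
rewrite !(linearZl, linearZr) !fpsD !fpsXZ0 !addr0.
by rewrite (eqmod_h0 (def.2 _ _)).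
Qed.

Lemma deformA : associative m.
Proof.
move=> x y z; have := congr1 (fun t : fps A => t 0%N) (def.1 (fpsC x) (fpsC y) (fpsC z)).
by rewrite !deform0.
Qed.

Lemma commDl v : {morph c^~ v : u u' / u + u'}.
Proof. by move=> u u'; rewrite /c linearDl linearDr opprD addrACA. Qed.

Lemma commDr u : {morph c u : v v' / v + v'}.
Proof. by move=> v v'; rewrite /c linearDl linearDr opprD addrACA. Qed.

Lemma commZl a u v : c (a *: u) v = a *: c u v.
Proof. by rewrite /c linearZl linearZr scalerBr. Qed.

Lemma commZr a u v : c u (a *: v) = a *: c u v.
Proof. by rewrite /c linearZl linearZr scalerBr. Qed.

Lemma comm0 u v : c u v 0%N = 0.
Proof. by rewrite fpsD fpsN !deform0 mC subrr. Qed.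

Lemma comm1 u v : c u v 1%N = br (u 0%N) (v 0%N).
Proof.
rewrite {1}(fps_split u) {1}(fps_split v) !(commDl, commDr, commZl, commZr).
rewrite -addrA -!scalerDr fpsD fpsXZS.
rewrite [X in _ + X]fpsD [X in _ + (_ + X)]fpsD fpsXZ0 !comm0 !addr0 /c.
have [q -> /eqmod_h0 qE] := qcl (u 0%N) (v 0%N).
by rewrite fpsXZS.
Qed.

Lemma qcl_poisson : is_poisson m br.
Proof.
have brE x y : br x y = c (fpsC x) (fpsC y) 1%N by rewrite comm1.
have split_c (u v : fps A) : c u v = fpsX *: Fps (fun n => c u v n.+1).
  rewrite {1}(fps_split (c u v)) comm0; suff -> : fpsC (0 : A) = 0 by rewrite add0r.
  by apply/fpsP => -[].
split=> [|x|x y z|||x y z] //.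
- split=> [y a x x'|x a y y'] /=; rewrite !brE fpsCD fpsCM.
    by rewrite commDl commZl fpsD fpsCZ.
  by rewrite commDr commZr fpsD fpsCZ.
- by rewrite brE /c subrr.
- have E (u v w : fps A) : br (br (u 0%N) (v 0%N)) (w 0%N) = c (c u v) w 2%N.
    rewrite -(comm1 u v) [in RHS](split_c u v) commZl fpsXZS.
    exact/esym/comm1.
  have J u v w : c (c u v) w + c (c v w) u + c (c w u) v = 0.
    rewrite /c !(linearBl, linearBr) /= !def.1 !opprB !addrA.
    rewrite [LHS](ACl ((1*8)*(2*11)*(3*6)*(4*9)*(5*12)*(7*10))) /=.
    by rewrite !(subrr, addNr, addr0).
  have := congr1 (fun t : fps A => t 2%N) (J (fpsC x) (fpsC y) (fpsC z)).
  by rewrite fps0 2!fpsD -!E.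
- exact: deformA.
- have cM u v w : c u (mh v w) = mh (c u v) w + mh v (c u w).
    by rewrite /c linearBl linearBr /= !def.1 addrA subrK.
  transitivity (c (fpsC x) (mh (fpsC y) (fpsC z)) 1%N).
    by rewrite comm1 deform0.
  rewrite cM (split_c (fpsC x) (fpsC y)) (split_c (fpsC x) (fpsC z)).
  by rewrite linearZl linearZr fpsD !fpsXZS !deform0 !brE.
Qed.

End QclPoisson.

(* Main.v *)
(** The coefficient of [h] in the product of two constants of [A_h] is a
   bilinear operation [mul1], and [br x y = mul1 x y - mul1 y x]. The AYBE and the
   invariance condition are linear in the product, so their coefficients of [h]
   say that [r] solves the AYBE for [mul1] and that [beta = r + flip r] is
   [mul1]-invariant. Lie invariance is the sum of the two (flipped) forms of
   invariance. Moreover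
     [C(r) = A(r) - (r13 r12 + r23 r13 - r12 r23)],
   and the subtracted term is the image of [A(r)] under the exchange of the
   first and third factors: replace [r21, r31, r32] by [beta12 - r12], etc.,
   and move products across [beta] by invariance. *)

From HB Require Import structures.
Require Import Defs.
From mathcomp Require Import all_boot all_order all_algebra.
From mathcomp Require Import boolp.

Set Implicit Arguments.
Unset Strict Implicit.
Unset Printing Implicit Defensive.

Import GRing.Theory.
Local Open Scope ring_scope.

(** * Tensor sums of functions given with a proof of bilinearity *)

Section TensorSums.
Variables (R : comNzRingType) (V W U : lmodType R) (f : V -> W -> U).
Hypothesis fB : bilinear_for *:%R *:%R f.

(** The functions summed in the Yang-Baxter expressions are bare lambdas; packing such an [f] with
    its proof [fB] gives access to the universal property. *)
Let fpack : {bilinear V -> W -> U} :=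
  HB.pack f (bilinear_isBilinear.Build R V W U *:%R *:%R f fB).

Lemma tsum_bilinear_pi s :
  tsum f (\pi_(tensor V W)%qT s) = \sum_(p <- s) f p.1 p.2.
Proof. exact: (tsum_pi fpack s). Qed.

Lemma tsum_bilinear_linear : linear (tsum f).
Proof. exact: (tsum_is_linear fpack). Qed.

Lemma tsum_bilinear_tens x y : tsum f (tens x y) = f x y.
Proof. exact: (tsum_tens fpack). Qed.

Lemma tsum_bilinear_sum (I : Type) (s : seq I) (F : I -> tensor V W) :
  tsum f (\sum_(i <- s) F i) = \sum_(i <- s) tsum f (F i).
Proof. exact: (linear_sum (tsum fpack)). Qed.

Lemma tsum_bilinearB : {morph tsum f : s t / s - t}.
Proof. exact: (linearB (tsum fpack)). Qed.

End TensorSums.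

Section CompletedTensorSums.
Variables (R : comNzRingType) (V W U : lmodType R).
Variable f : fps V -> fps W -> fps U.
Hypothesis fB : bilinear_for *:%R *:%R f.

Let fpack : {bilinear fps V -> fps W -> fps U} :=
  HB.pack f (bilinear_isBilinear.Build (fps R) (fps V) (fps W) (fps U)
    *:%R *:%R f fB).

(** A constant series is a finite sum of [ctens] of constants, and [csum f] agrees with [f] on each
    of these. *)
Lemma csum_bilinear_fpsC t :
  csum f (fpsC t) = \sum_(p <- repr t) f (fpsC p.1) (fpsC p.2).
Proof.
rewrite [t in LHS]tens_decomp (big_morph _ (@fpsCD _ _) (erefl _)).
rewrite (linear_sum (csum fpack)); apply: eq_bigr => p _.
have <- : ctens (fpsC p.1) (fpsC p.2) = fpsC (tens p.1 p.2) by exact: ctensC.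
exact: (csum_ctens fpack).
Qed.

End CompletedTensorSums.

Lemma bilinear_comp (R : comNzRingType) (V V' W W' U : lmodType R)
    (f : V -> W -> U) (g : V' -> V) (h : W' -> W) :
  bilinear_for *:%R *:%R f -> linear g -> linear h ->
  bilinear_for *:%R *:%R (fun x y => f (g x) (h y)).
Proof.
move=> [fl fr] gL hL; split=> [z a x x'|z a x x'] /=; rewrite (gL, hL).
  exact: fl.
exact: fr.
Qed.

Lemma tens_bilinear (R : comNzRingType) (V W : lmodType R) :
  bilinear_for *:%R *:%R (@tens R V W).
Proof.
by split=> [y a x x'|x a y y'] /=; rewrite ?tensDl ?tensDr ?tensZl ?tensZr.
Qed.

Lemma sum_bilinear (K : comNzRingType) (U V W : lmodType K)
    (I : Type) (s : seq I) (F : I -> U -> V -> W) :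
  (forall i, bilinear_for *:%R *:%R (F i)) ->
  bilinear_for *:%R *:%R (fun x y => \sum_(i <- s) F i x y).
Proof.
move=> FB; split=> [z a x y|z a x y] /=; rewrite scaler_sumr -big_split;
  by apply: eq_bigr => i _; case: (FB i) => l r; rewrite (l, r).
Qed.

Lemma fps_coef_sum (V : zmodType) (I : Type) (s : seq I) (F : I -> fps V) n :
  (\sum_(i <- s) F i) n = \sum_(i <- s) F i n.
Proof.
exact: (big_morph (fun u : fps V => u n) (fun u v => fpsD u v n) (fps0 V n)).
Qed.

Lemma ctens_fpsCl (R : comNzRingType) (V W : lmodType R) (x : V) (u : fps W) n :
  ctens (fpsC x) u n = tens x (u n).
Proof.
by rewrite /ctens cauchyCl // => z; rewrite -[0](scale0r 0) tensZl scale0r.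
Qed.

Lemma ctens_fpsCr (R : comNzRingType) (V W : lmodType R) (u : fps V) (y : W) n :
  ctens u (fpsC y) n = tens (u n) y.
Proof.
(* Only the last index contributes: for [i < n], [fpsC y] is read at [n - i > 0], where it
   vanishes. *)
rewrite /= big_ord_recr /= subnn big1 => [|i _]; first by rewrite add0r.
have := ltn_ord i; rewrite -subn_gt0 /=; case: (n - i)%N => //= k _.
by rewrite -[0](scale0r 0) tensZr scale0r.
Qed.

(** * Invariance of the symmetrized tensor *)

Section Symmetrization.
Variables (R : comNzRingType) (A : lmodType R) (m : {bilinear A -> A -> A}).
Variable r : tensor A A.

Let s := repr r.
Let swap (p : A * A) := (p.2, p.1).
(** Chosen rather than [repr (r + flip r)] because this list is visibly stable under [swap], up to
    order. *)
Let t := s ++ map swap s.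

Lemma symmetrization_pi : r + flip r = (\pi_(tensor A A) t)%qT.
Proof.
rewrite piD reprK; congr (_ + _).
by rewrite tens_pi big_map.
Qed.

Lemma symmetrization_swap (U : zmodType) (f : A -> A -> U) :
  \sum_(p <- t) f p.1 p.2 = \sum_(p <- t) f p.2 p.1.
Proof. by rewrite !big_cat !big_map /= addrC. Qed.

Lemma symmetrization_sum (U : zmodType) (f : A -> A -> U) :
  \sum_(p <- t) f p.1 p.2 = \sum_(p <- s) f p.1 p.2 + \sum_(p <- s) f p.2 p.1.
Proof. by rewrite !big_cat !big_map. Qed.

Hypothesis r_inv : assoc_invariant m (r + flip r).

(** Applying the linear map [tsum f] to the invariance identity in the tensor square lets invariance
    be used inside any bilinear expression. *)
Lemma symmetrization_invariant (U : lmodType R) (f : A -> A -> U) x :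
  bilinear_for *:%R *:%R f ->
  \sum_(p <- t) f p.1 (m x p.2) = \sum_(p <- t) f (m p.1 x) p.2.
Proof.
move=> fB; have := r_inv x; rewrite symmetrization_pi /tmap.
rewrite !tsum_bilinear_pi; last 2 first.
- by apply: bilinear_comp => [|a y z|a y z] //=;
  [apply: tens_bilinear|apply: linearPl].
- by apply: bilinear_comp => [|a y z|a y z] //=;
  [apply: tens_bilinear|apply: linearPr].
move=> /eqP; rewrite subr_eq0 => /eqP /(congr1 (tsum f)).
rewrite !(tsum_bilinear_sum fB) => E.
rewrite (eq_bigr _ (fun p _ => esym (tsum_bilinear_tens fB _ _))) E.
by apply: eq_bigr => p _; rewrite tsum_bilinear_tens.
Qed.

Lemma symmetrization_invariant_swap (U : lmodType R) (f : A -> A -> U) x :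
  bilinear_for *:%R *:%R f ->
  \sum_(p <- t) f (m x p.1) p.2 = \sum_(p <- t) f p.1 (m p.2 x).
Proof.
move=> fB.
rewrite (symmetrization_swap (fun u v => f (m x u) v)).
rewrite [RHS](symmetrization_swap (fun u v => f u (m v x))).
by apply: (@symmetrization_invariant _ (fun u v => f v u)); case: fB.
Qed.

Let br x y := m x y - m y x.

Lemma commutator_linear x : linear (br x).
Proof.
move=> a y y'; rewrite /br linearPr linearPl scalerBr opprD.
by rewrite addrACA.
Qed.

Lemma lie_invariant_commutator : lie_invariant br (r + flip r).
Proof.
move=> x; rewrite symmetrization_pi /tmap.
rewrite !tsum_bilinear_pi; last 2 first.
- by apply: bilinear_comp => //;
  [apply: tens_bilinear|apply: commutator_linear].
- by apply: bilinear_comp => //;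
  [apply: tens_bilinear|apply: commutator_linear].
have E1 := symmetrization_invariant x (tens_bilinear A A).
have E2 := symmetrization_invariant_swap x (tens_bilinear A A).
rewrite -big_split /=.
(* Left multiplication in one slot is paired with right multiplication in the other, so that each
   pair cancels by one form of invariance. *)
rewrite (eq_bigr (fun p => (tens (m x p.1) p.2 - tens p.1 (m p.2 x))
   + (tens p.1 (m x p.2) - tens (m p.1 x) p.2))); last first.
  move=> p _; rewrite /br !(tensDl, tensDr) -!scaleN1r tensZl tensZr !scaleN1r.
  by rewrite addrA [LHS](ACl ((1*4)*(3*2))).
by rewrite big_split /= !sumrB E1 E2 !subrr addr0.
Qed.

(** Splitting each sum over [t] into its [r] and [flip r] halves gives the relation in terms of
    [repr r], as the Yang-Baxter sums require. *)
Lemma symmetrization_cross (U : lmodType R) (f : A -> A -> U) x :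
  bilinear_for *:%R *:%R f ->
  \sum_(p <- s) f p.1 (m p.2 x) + \sum_(p <- s) f p.2 (m p.1 x) =
  \sum_(p <- s) f (m x p.1) p.2 + \sum_(p <- s) f (m x p.2) p.1.
Proof.
move=> fB; rewrite -(symmetrization_sum (fun u v => f u (m v x))).
rewrite -(symmetrization_sum (fun u v => f (m x u) v)).
exact/esym/symmetrization_invariant_swap.
Qed.

End Symmetrization.

(** * From the AYBE and invariance to the CYBE for the commutator *)

Section AybeCybe.
Variables (R : comNzRingType) (A : lmodType R).
Implicit Type m : {bilinear A -> A -> A}.

Definition rev_tens3 : tensor (tensor A A) A -> tensor (tensor A A) A :=
  tsum (fun w z => tsum (fun x y => tens3 z y x) w).

Lemma tens3_linear1 (y z : A) : linear (fun x : A => tens3 x y z).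
Proof. by move=> a x x'; rewrite /tens3 !tensDl !tensZl. Qed.

Lemma tens3_linear2 (x z : A) : linear (fun y : A => tens3 x y z).
Proof. by move=> a y y'; rewrite /tens3 !(tensDl, tensDr) !(tensZl, tensZr). Qed.

Lemma tens3_linear3 (x y : A) : linear (fun z : A => tens3 x y z).
Proof. by move=> a z z'; rewrite /tens3 !tensDr !tensZr. Qed.

Let rev_bilinear2 z : bilinear_for *:%R *:%R (fun x y : A => tens3 z y x).
Proof. by split=> [y|x]; [apply: tens3_linear3|apply: tens3_linear2]. Qed.

Let rev_bilinear : bilinear_for *:%R *:%R
  (fun (w : tensor A A) (z : A) => tsum (fun x y => tens3 z y x) w).
Proof.
split=> [z|w] /=; first exact: tsum_bilinear_linear.
move=> a z z'; rewrite /tsum scaler_sumr -big_split.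
by apply: eq_bigr => p _ /=; rewrite tens3_linear1.
Qed.

HB.instance Definition _ := GRing.isLinear.Build R (tensor (tensor A A) A)
  (tensor (tensor A A) A) *:%R rev_tens3 (tsum_bilinear_linear rev_bilinear).

Lemma rev_tens3E x y z : rev_tens3 (tens3 x y z) = tens3 z y x.
Proof. by rewrite /rev_tens3 !tsum_bilinear_tens. Qed.

Lemma rev_tens3_sum (s : seq (A * A)) (F G H : A * A -> A * A -> A) :
  rev_tens3 (\sum_(p <- s) \sum_(q <- s) tens3 (F p q) (G p q) (H p q)) =
  \sum_(p <- s) \sum_(q <- s) tens3 (H p q) (G p q) (F p q).
Proof.
rewrite linear_sum; apply: eq_bigr => p _.
rewrite linear_sum; apply: eq_bigr => q _.
exact: rev_tens3E.
Qed.

Lemma cybe_commutator m (r : tensor A A) :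
  aybe m r -> assoc_invariant m (r + flip r) ->
  cybe (fun x y => m x y - m y x) r.
Proof.
rewrite /aybe /cybe /aybe_expr /cybe_expr /tsum.
move=> AY r_inv; have cross := symmetrization_cross r_inv.
set s := repr r in AY cross *.
pose S (F : A * A -> A * A -> tensor (tensor A A) A) :=
  \sum_(p <- s) \sum_(q <- s) F p q.
have SC F : S F = S (fun p q => F q p) by rewrite /S exchange_big.
have SD F G : S (fun p q => F p q + G p q) = S F + S G.
  by rewrite /S -big_split; apply: eq_bigr => p _; rewrite big_split.
have SB F G : S (fun p q => F p q - G p q) = S F - S G.
  by rewrite /S -sumrB; apply: eq_bigr => p _; rewrite sumrB.
(* The reversed AYBE: [r32 r31 + r31 r21 - r21 r32 = 0]. *)
have AYr : S (fun p q => tens3 q.2 p.2 (m p.1 q.1))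
    + S (fun p q => tens3 (m p.2 q.2) q.1 p.1)
    - S (fun p q => tens3 p.2 (m p.1 q.2) q.1) = 0.
  have := congr1 rev_tens3 AY.
  by rewrite linearB linearD linear0 /= !rev_tens3_sum.
(* For each fixed [q], the leg [x q] is moved across the symmetrized sum over [p], while [f q]
   places the other leg. *)
have cr f : (forall q, bilinear_for *:%R *:%R (f q)) ->
    forall x : A * A -> A,
    S (fun p q => f q p.1 (m p.2 (x q))) + S (fun p q => f q p.2 (m p.1 (x q)))
  = S (fun p q => f q (m (x q) p.1) p.2) + S (fun p q => f q (m (x q) p.2) p.1).
  move=> fB x; rewrite !(SC (fun p q => f q _ _)) -!SD.
  rewrite /S; apply: eq_bigr => q _; rewrite !big_split; exact: cross.
(* beta23 r31 = r21 beta23, beta13 r21 = r23 beta13, beta12 r23 = r13 beta12 *)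
have {}cr : S (fun p q => tens3 (m q.1 p.1) p.2 q.2)
    + S (fun p q => tens3 p.1 q.1 (m q.2 p.2))
    = S (fun p q => tens3 p.1 (m p.2 q.1) q.2).
  have c23 := cr (fun q u v => tens3 q.2 u v)
    (fun q => conj (fun y => tens3_linear2 q.2 y) (fun y => tens3_linear3 q.2 y))
    fst.
  have c13 := cr (fun q u v => tens3 v q.1 u)
    (fun q => conj (fun y => tens3_linear3 y q.1) (fun y => tens3_linear1 q.1 y))
    snd.
  have c12 := cr (fun q u v => tens3 u v q.2)
    (fun q => conj (fun y => tens3_linear1 y q.2) (fun y => tens3_linear2 y q.2))
    fst.
  (* Exchanging [p] and [q] makes equal products syntactically equal, so that generalization leaves
     only nine unknowns. *)
  rewrite [X in _ = _ + X]SC addrC in c23.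
  rewrite [X in _ = X + _]SC in c13.
  rewrite [X in _ + X = _]SC [X in _ = _ + X]SC in c12.
  move: AYr c23 c13 c12.
  move: (S _) (S _) (S _) (S _) (S _) (S _) (S _) (S _) (S _).
  move=> x1 x3 x2 z w u y3 y2 y1 /eqP; rewrite subr_eq0 => /eqP AYr e1 e2 e3.
  (* In the sum of the three relations the mixed products [u = r23 r31], [z = r13 r21] and
     [w = r21 r23] occur on both sides; the reversed AYBE equates [y1 + y2] with [y3]. *)
  apply: (addIr (u + z + w + y3)).
  transitivity ((w + y3) + (u + x2) + (x1 + z)).
    by rewrite !addrA [LHS](ACl (5*6*3*2*1*4)).
  rewrite -e1 -e2 -e3 -AYr !addrA.
  by rewrite [LHS](ACl (5*2*4*6*1*3)).
have B1 y z := zmod_morphism_linear (tens3_linear1 y z).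
have B2 x z := zmod_morphism_linear (tens3_linear2 x z).
have B3 x y := zmod_morphism_linear (tens3_linear3 x y).
transitivity (
  S (fun p q => tens3 (m p.1 q.1) p.2 q.2 - tens3 (m q.1 p.1) p.2 q.2)
  + S (fun p q => tens3 p.1 (m p.2 q.1) q.2 - tens3 p.1 (m q.1 p.2) q.2)
  + S (fun p q => tens3 p.1 q.1 (m p.2 q.2) - tens3 p.1 q.1 (m q.2 p.2))).
  congr (_ + _ + _); apply: eq_bigr => p _; apply: eq_bigr => q _.
  - exact: B1.
  - exact: B2.
  - exact: B3.
(* Replacing [r12 r23] by [r13 r12 + r23 r13] cancels the opposite products and leaves
   [r12 r13 + r13 r23 - r23 r12], the AYBE expression. *)
rewrite !SB -cr [S (fun p q => tens3 p.1 (m q.1 p.2) q.2)]SC.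
move: AY; rewrite -/(S _) -/(S _) -/(S _).
move: (S _) (S _) (S _) (S _) (S _) => a1 a2 a3 a4 a5 AY.
by rewrite !addrA [LHS](ACl ((1*6*5)*(2*3)*(4*7))) /= addNr subrr !addr0.
Qed.

End AybeCybe.

(** * First-order coefficients of the deformed conditions *)

Section FirstOrder.
Variables (R : comNzRingType) (A : lmodType R).
Variable mh : {bilinear fps A -> fps A -> fps A}.

(** For an associative deformation this is its infinitesimal Hochschild 2-cocycle. It need not be
    associative, hence the arbitrary bilinear product in the preceding sections. *)
Definition mul1 (x y : A) : A := mh (fpsC x) (fpsC y) 1%N.

Lemma mul1_bilinear : bilinear_for *:%R *:%R mul1.
Proof.
by split=> [z a x y|z a x y] /=; rewrite /mul1 fpsCD fpsCM (linearPl, linearPr)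
  fpsD fpsCZ.
Qed.

HB.instance Definition _ := bilinear_isBilinear.Build R A A A *:%R *:%R
  mul1 mul1_bilinear.

Lemma ctens3_coef1 (u : fps A) y z n :
  ctens3 u (fpsC y) (fpsC z) n = tens3 (u n) y z.
Proof. by rewrite /ctens3 !ctens_fpsCr. Qed.

Lemma ctens3_coef2 x (u : fps A) z n :
  ctens3 (fpsC x) u (fpsC z) n = tens3 x (u n) z.
Proof. by rewrite /ctens3 ctens_fpsCr ctens_fpsCl. Qed.

Lemma ctens3_coef3 x y (u : fps A) n :
  ctens3 (fpsC x) (fpsC y) u n = tens3 x y (u n).
Proof. by rewrite /ctens3 ctensC ctens_fpsCl. Qed.

(** Brings the deformed Yang-Baxter sums to finite double sums over [repr r], the shape that [tsum]
    unfolds to, so that coefficients can be compared term by term. *)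
Lemma csum2_fpsC (U : lmodType R)
    (f : fps A -> fps A -> fps A -> fps A -> fps U) r :
  (forall a b, bilinear_for *:%R *:%R (f a b)) ->
  (forall c d, bilinear_for *:%R *:%R (fun a b => f a b c d)) ->
  csum (fun a b => csum (f a b) (fpsC r)) (fpsC r) =
  \sum_(p <- repr r) \sum_(q <- repr r)
    f (fpsC p.1) (fpsC p.2) (fpsC q.1) (fpsC q.2).
Proof.
move=> fB1 fB2.
have -> : (fun a b => csum (f a b) (fpsC r)) =
    (fun a b => \sum_(q <- repr r) f a b (fpsC q.1) (fpsC q.2)).
  by apply/funext => a; apply/funext => b; rewrite csum_bilinear_fpsC.
by rewrite csum_bilinear_fpsC //; apply: sum_bilinear => q; apply: fB2.
Qed.

Lemma aybe_mul1 r : caybe mh (fpsC r) -> aybe mul1 r.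
Proof.
rewrite /caybe /aybe /aybe_expr /tsum.
rewrite !csum2_fpsC; try by move=> a b; split=> [z c x y|z c x y] /=;
  rewrite /ctens3 ?(linearPl, linearPr).
move=> /(congr1 (fun u : fps _ => u 1%N)).
rewrite fps0 2!fpsD fpsN !fps_coef_sum => AY.
rewrite -[RHS]AY; congr (_ + _ - _); apply: eq_bigr => p _;
  rewrite fps_coef_sum; apply: eq_bigr => q _.
- by rewrite ctens3_coef1.
- by rewrite ctens3_coef3.
- by rewrite ctens3_coef2.
Qed.

Lemma cflip_fpsC (r : tensor A A) : cflip (fpsC r) = fpsC (flip r).
Proof.
(* In positive degree the claim is [flip 0 = 0], obtained by writing [0] as [0 - 0]. *)
apply/fpsP => -[|n] //=; rewrite /flip -{1}(subrr 0) tsum_bilinearB ?subrr //.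
by split=> [z a x y|z a x y] /=; rewrite ?tensDl ?tensDr ?tensZl ?tensZr.
Qed.

Lemma assoc_invariant_mul1 b :
  cassoc_invariant mh (fpsC b) -> assoc_invariant mul1 b.
Proof.
move=> b_inv x; have := congr1 (fun u : fps _ => u 1%N) (b_inv (fpsC x)).
rewrite /cmap fpsD fpsN fps0 !csum_bilinear_fpsC; last 2 first.
- by split=> [z a u v|z a u v] /=; rewrite ?(linearPl, linearPr).
- by split=> [z a u v|z a u v] /=; rewrite ?(linearPl, linearPr).
rewrite !fps_coef_sum /tmap /tsum => E; rewrite -[RHS]E.
congr (_ - _); apply: eq_bigr => p _.
  by rewrite ctens_fpsCl.
by rewrite ctens_fpsCr.
Qed.

(** The commutator of two constants is [fpsX *: q], so its coefficient of [h] is the constant term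
    of [q], which is the bracket. *)
Lemma qcl_commutator br : is_qcl mh br -> br = fun x y => mul1 x y - mul1 y x.
Proof.
move=> qcl; apply/funext => x; apply/funext => y.
have [q E /eqmod_h0 /= <-] := qcl x y.
by rewrite /mul1 -fpsN -fpsD E fpsXZS.
Qed.

End FirstOrder.

Theorem theorem4p4 (k : fieldType) (char_k : [pchar k] =i pred0)
    (A : lmodType k) (m : {bilinear A -> A -> A})
    (mA : associative m) (mC : commutative m)
    (mh : {bilinear fps A -> fps A -> fps A}) (mh_def : is_deformation m mh)
    (br : A -> A -> A) (br_qcl : is_qcl mh br)
    (r : tensor A A)
    (r_aybe : aybe m r)
    (r_inv : assoc_invariant m (r + flip r))
    (hr_aybe : caybe mh (fpsC r))
    (hr_inv : cassoc_invariant mh (fpsC r + cflip (fpsC r))) :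
  pybe m br r /\ poisson_invariant m br (r + flip r).
Proof.
have r_inv1 : assoc_invariant (mul1 mh) (r + flip r).
  by apply: assoc_invariant_mul1; rewrite fpsCD -cflip_fpsC.
(* The two conditions on [m] are hypotheses; the CYBE and Lie invariance remain, for the commutator
   of [mul1 mh]. *)
rewrite (qcl_commutator br_qcl); split; split=> //.
  exact/cybe_commutator/r_inv1/aybe_mul1.
exact: lie_invariant_commutator.
Qed.
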